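(* Let $l\ge 1$ and let $S=\{(p_i,q_i)\mid i=1,\dots,l\}\subset(\{-1\}\cup\mathbb{N})\times\mathbb{N}$ be a set of $l$ distinct pairs with $p_i+q_i\ge 1$ for all $i$. Then the Sibirsky ideal $$I_{sym}=\langle [\nu]-[\bar\nu]\;\mid\;\nu\in\mathcal{M}\rangle\subset\mathbb{C}[a,b]$$ of the polynomial system with index set $S$ is a prime ideal of $\mathbb{C}[a,b]$.
   Context: $\mathbb{N}$ denotes the nonnegative integers. The set $S$ indexes the coefficients of the polynomial differential system $$\dot x=x-\sum_{(p,q)\in S}a_{pq}x^{p+1}y^q,\qquad \dot y=-\Big(y-\sum_{(p,q)\in S}b_{qp}x^qy^{p+1}\Big).$$ $\mathbb{C}[a,b]$ is the polynomial ring in the $2l$ variables $a_{p_iq_i},b_{q_ip_i}$, $i=1,\dots,l$. Define $L:\mathbb{N}^{2l}\to\mathbb{Z}^2$ by $$L(\nu)=\binom{p_1}{q_1}\nu_1+\cdots+\binom{p_l}{q_l}\nu_l+\binom{q_l}{p_l}\nu_{l+1}+\cdots+\binom{q_1}{p_1}\nu_{2l}.$$ $\mathcal{M}$ is the monoid of all $\nu\in\mathbb{N}^{2l}$ such that $L(\nu)=\binom{k}{k}$ for some $k\in\mathbb{N}$. For $\nu\in\mathbb{N}^{2l}$, $[\nu]$ denotes the monomial $a_{p_1q_1}^{\nu_1}\cdots a_{p_lq_l}^{\nu_l}\,b_{q_lp_l}^{\nu_{l+1}}b_{q_{l-1}p_{l-1}}^{\nu_{l+2}}\cdots b_{q_1p_1}^{\nu_{2l}}$,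 and $\bar\nu=(\nu_{2l},\nu_{2l-1},\dots,\nu_1)$. *)

(* Defs.v *)
From HB Require Import structures.
From mathcomp Require Import all_boot all_order all_algebra.
From mathcomp Require Import complex mpoly.
From mathcomp Require Import boolp classical_sets reals.

Set Implicit Arguments.
Unset Strict Implicit.
Unset Printing Implicit Defensive.

Import Order.TTheory GRing.Theory Num.Theory.

Local Open Scope classical_set_scope.
Local Open Scope ring_scope.

(* Boolean only so as to fit idealr_closed and prime_idealr_closed of
   ring_quotient; G may be infinite. *)
Definition ideal_gen (A : comNzRingType) (G : set A) : {pred A} :=
  fun f => `[< exists (n : nat) (c g : 'I_n -> A),
    (forall i, G (g i)) /\ f = \sum_(i < n) c i * g i >].

Definition prime_ideal (A : comNzRingType) (I : {pred A}) : Prop :=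
  idealr_closed I /\ prime_idealr_closed I.

(* The family ((p i, q i))_(i < l) lists the index set S, with indices shifted
   to start at 0. The 2l variables are numbered as the exponents nu are: the
   variable lshift l i is a_{p_i q_i}, and the variable rshift l j is
   b_{q_i p_i} with i = rev_ord j, so the b's come in reverse order. *)
Section Sibirsky.
Variables (l : nat) (p : 'I_l -> int) (q : 'I_l -> nat).

Definition Lmap (nu : 'X_{1..l + l}) : int * int :=
  \sum_(i < l) (p i, (q i)%:Z) *+ nu (lshift l i) +
  \sum_(j < l) ((q (rev_ord j))%:Z, p (rev_ord j)) *+ nu (rshift l j).

Definition sibirsky_monoid : set 'X_{1..l + l} :=
  [set nu | exists k : nat, Lmap nu = (k%:Z, k%:Z)].

Definition mnm_bar (nu : 'X_{1..l + l}) : 'X_{1..l + l} :=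
  [multinom nu (rev_ord i) | i < l + l].

Definition sibirsky_ideal (R : realType) : {pred {mpoly R[i][l + l]}} :=
  ideal_gen [set 'X_[R[i], nu] - 'X_[R[i], mnm_bar nu]
            | nu in sibirsky_monoid].

End Sibirsky.

Arguments sibirsky_ideal {l} p q R.

(* Main.v *)
Require Import Defs.
From HB Require Import structures.
From mathcomp Require Import all_boot all_order all_algebra.
From mathcomp Require Import complex mpoly.
From mathcomp Require Import boolp classical_sets reals.
From mathcomp Require Import zify.

Set Implicit Arguments.
Unset Strict Implicit.
Unset Printing Implicit Defensive.

Import Order.TTheory GRing.Theory Num.Theory.
Local Open Scope ring_scope.

(** The Sibirsky ideal is prime because it is a toric ideal: it is the kernel
    of a ring morphism [toric_map] sending each variable to a monomial of
    another polynomial ring, and that ring is an integral domain.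

    Write [a_i] for the first component of the weight with which the [i]-th
    variable enters [L]. Since reversing the list of variables exchanges the
    two components of the weights, the second component is [a_(rev i)]. The
    morphism sends the [i]-th variable to [t ^ (a_i + 1) * y_i * y_(rev i)];
    the hypotheses make the exponent [a_i + 1] a natural number, so no Laurent
    polynomials are needed. Adding 1 to every weight is harmless since the
    [y]-part of the image of a monomial already determines the degree of that
    monomial.

    Any such kernel is spanned by the binomials [X^m - X^m'] whose two
    monomials have the same image ([ker_toric_map_sub]). Here, removing the
    common factor of two such monomials leaves [X^nu] and [X^(bar nu)]
    ([bar_decomposition]), because the sums [m_i + m_(rev i)] are fixed and
    the supports have become disjoint. Equality of the [t]-exponents then says
    that the two components of [L nu] agree ([toric_exp_eq_bar]), and they are
    nonnegative since [p_i + q_i >= 1]; so [nu] lies in the monoid, and the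
    binomial is a multiple of a generator of the ideal. *)

(** * Generated ideals *)

Section IdealGen.
Variables (A : comNzRingType) (G : set A).

Lemma mem_ideal_gen g : G g -> g \in ideal_gen G.
Proof.
move=> Gg; apply/asboolP; exists 1%N, (fun=> 1), (fun=> g); split=> //.
by rewrite big_ord1 mul1r.
Qed.

Lemma ideal_gen0 : 0 \in ideal_gen G.
Proof.
apply/asboolP; exists 0%N, (fun=> 0), (fun=> 0); split=> [[]//|].
by rewrite big_ord0.
Qed.

Lemma ideal_genMD a u v :
  u \in ideal_gen G -> v \in ideal_gen G -> a * u + v \in ideal_gen G.
Proof.
move=> /asboolP[m [c [g [Gg ->]]]] /asboolP[n [d [h [Gh ->]]]].
apply/asboolP; exists (m + n)%N.
exists (fun k => match split k with inl i => a * c i | inr j => d j end).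
exists (fun k => match split k with inl i => g i | inr j => h j end).
split=> [k|]; first by case: (split k).
rewrite big_split_ord /= mulr_sumr; congr (_ + _); apply: eq_bigr => i _.
  by rewrite (unsplitK (inl i)) mulrA.
by rewrite (unsplitK (inr i)).
Qed.

Lemma ideal_genM a u : u \in ideal_gen G -> a * u \in ideal_gen G.
Proof. by move=> Gu; rewrite -[a * u]addr0 ideal_genMD ?ideal_gen0. Qed.

Lemma ideal_gen_sum (I : eqType) (r : seq I) (F : I -> A) :
  (forall i, i \in r -> F i \in ideal_gen G) ->
  \sum_(i <- r) F i \in ideal_gen G.
Proof.
move=> GF; rewrite big_seq; apply: (big_ind (fun x => x \in ideal_gen G)) => //.
  exact: ideal_gen0.
by move=> x y Gx Gy; rewrite -[x]mul1r ideal_genMD.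
Qed.

Lemma ideal_gen_sub_ker (B : pzRingType) (f : {rmorphism A -> B}) :
  (forall g, G g -> f g = 0) -> forall u, u \in ideal_gen G -> f u = 0.
Proof.
move=> fG0 u /asboolP[n [c [g [Gg ->]]]]; rewrite rmorph_sum big1 // => i _.
by rewrite rmorphM (fG0 (g i)) // mulr0.
Qed.

Lemma prime_ideal_gen_ker (B : idomainType) (f : {rmorphism A -> B}) :
  (forall u, (u \in ideal_gen G) = (f u == 0)) -> prime_ideal (ideal_gen G).
Proof.
move=> kerE; split; first split.
- exact: ideal_gen0.
- by rewrite kerE rmorph1 oner_eq0.
- by move=> a u v; apply: ideal_genMD.
by move=> u v; rewrite !kerE rmorphM mulf_eq0.
Qed.

End IdealGen.

(** * Toric ideals *)

Section Toric.
Variables (A : idomainType) (n k : nat) (v : 'I_n -> 'X_{1..k}).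

Definition toric_exp (m : 'X_{1..n}) : 'X_{1..k} := (\sum_i v i *+ m i)%MM.

Definition toric_map : {mpoly A[n]} -> {mpoly A[k]} :=
  mmap (@mpolyC k A) (fun i => 'X_[v i]).

HB.instance Definition _ := GRing.RMorphism.on toric_map.

Lemma toric_expE m j : toric_exp m j = (\sum_i v i j * m i)%N.
Proof.
rewrite mnm_sumE; apply: eq_bigr => i _.
by rewrite mulmnE.
Qed.

Lemma toric_mapX m : toric_map 'X_[m] = 'X_[toric_exp m].
Proof.
rewrite /toric_map mmapX /mmap1 /toric_exp.
rewrite (big_morph _ (@mpolyXD _ A) (@mpolyX0 _ A)).
by apply: eq_bigr => i _; rewrite mpolyXn.
Qed.

Lemma toric_mapZ c f : toric_map (c *: f) = c *: toric_map f.
Proof. by rewrite /toric_map mmapZ mul_mpolyC. Qed.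

Lemma mcoeff_toric_map f u :
  (toric_map f)@_u = \sum_(m <- msupp f | toric_exp m == u) f@_m.
Proof.
rewrite {1}[f]mpolyE rmorph_sum raddf_sum /= [RHS]big_mkcond /=.
apply: eq_bigr => m _; rewrite toric_mapZ toric_mapX mcoeffZ mcoeffX.
by case: eqP => _; rewrite ?mulr1 ?mulr0.
Qed.

(** Replacing every monomial of [f] by a fixed representative of its fibre
    under [toric_exp] changes [f] by a combination of binomials, and turns an
    element of the kernel into 0: the coefficients over one fibre add up to a
    coefficient of [toric_map f]. *)
Lemma ker_toric_map_sub (G : set {mpoly A[n]}) :
  (forall m m', toric_exp m = toric_exp m' ->
     'X_[m] - 'X_[m'] \in ideal_gen G) ->
  forall f, toric_map f = 0 -> f \in ideal_gen G.
Proof.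
move=> Gbin f f0.
pose rep u := xget 0%MM [set m | toric_exp m = u]%classic.
have repE m : toric_exp (rep (toric_exp m)) = toric_exp m.
  by apply: (@xgetPex _ 0%MM [set m' | toric_exp m' = toric_exp m]%classic); exists m.
pose s := undup [seq toric_exp m | m <- msupp f].
have rep0 : \sum_(m <- msupp f) f@_m *: 'X_[A, rep (toric_exp m)] = 0.
  transitivity (\sum_(m <- msupp f) \sum_(u <- s | toric_exp m == u)
                  f@_m *: 'X_[A, rep u]).
    apply: eq_big_seq => m fm.
    rewrite (big_rem (toric_exp m)) /=; last first.
      by rewrite mem_undup map_f.
    rewrite eqxx big_seq_cond big1 ?addr0 // => u /andP[].
    by rewrite mem_rem_uniq ?undup_uniq // inE => /andP[/eqP ne _] /eqP/esym.
  rewrite (exchange_big_dep predT) //= big1 // => u _.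
  by rewrite -scaler_suml -mcoeff_toric_map f0 mcoeff0 scale0r.
have -> : f = \sum_(m <- msupp f) f@_m *: ('X_[m] - 'X_[rep (toric_exp m)]).
  under eq_bigr do rewrite scalerBr.
  by rewrite sumrB rep0 subr0 -mpolyE.
apply: ideal_gen_sum => m _; rewrite -mul_mpolyC.
by apply: ideal_genM; apply: Gbin; rewrite repE.
Qed.

Lemma toric_prime_ideal (G : set {mpoly A[n]}) :
  (forall g, G g -> toric_map g = 0) ->
  (forall m m', toric_exp m = toric_exp m' ->
     'X_[m] - 'X_[m'] \in ideal_gen G) ->
  prime_ideal (ideal_gen G).
Proof.
move=> Gker Gbin; apply: (prime_ideal_gen_ker (f := toric_map)) => u.
apply/idP/eqP; first exact: ideal_gen_sub_ker.
exact: ker_toric_map_sub.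
Qed.

End Toric.

(** * Reversal of exponent vectors *)

Section Bar.
Variable l : nat.
Implicit Types m : 'X_{1..l + l}.

Lemma mnm_barE m i : mnm_bar m i = m (rev_ord i).
Proof. by rewrite mnmE. Qed.

Lemma mdeg_bar m : mdeg (mnm_bar m) = mdeg m.
Proof.
rewrite !mdegE (reindex_inj rev_ord_inj) /=.
by apply: eq_bigr => i _; rewrite mnm_barE rev_ordK.
Qed.

(** With [m0] the excess of [m] over [m'], the remaining factor is the greatest
    common divisor; what is left of [m] and [m'] has disjoint supports, so
    that at each pair [i], [rev i] their common sum sits at one place for the
    former and at the other place for the latter. *)
Lemma bar_decomposition m m' :
  (forall i, m i + m (rev_ord i) = m' i + m' (rev_ord i))%N ->
  exists g m0, m = (g + m0)%MM /\ m' = (g + mnm_bar m0)%MM.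
Proof.
move=> mm'; exists [multinom minn (m i) (m' i) | i < l + l], (m - m')%MM.
split; apply/mnmP => i; rewrite mnmDE ?mnm_barE mnmBE mnmE; move: (mm' i); lia.
Qed.

End Bar.

(** * The Sibirsky ideal *)

Section Sibirsky.
Variables (l : nat) (p : 'I_l -> int) (q : 'I_l -> nat).
Implicit Types (m nu : 'X_{1..l + l}) (i : 'I_(l + l)).

Definition weight i : int :=
  match split i with inl j => p j | inr j => (q (rev_ord j))%:Z end.

Lemma weight_lshift (j : 'I_l) : weight (lshift l j) = p j.
Proof. by rewrite /weight (unsplitK (inl j)). Qed.

Lemma weight_rshift (j : 'I_l) : weight (rshift l j) = (q (rev_ord j))%:Z.
Proof. by rewrite /weight (unsplitK (inr j)). Qed.

Lemma rev_lshift (j : 'I_l) : rev_ord (lshift l j) = rshift l (rev_ord j).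
Proof. by apply: val_inj => /=; have := ltn_ord j; lia. Qed.

Lemma rev_rshift (j : 'I_l) : rev_ord (rshift l j) = lshift l (rev_ord j).
Proof. by apply: val_inj => /=; have := ltn_ord j; lia. Qed.

Lemma LmapE nu :
  Lmap p q nu = (\sum_i weight i *+ nu i, \sum_i weight (rev_ord i) *+ nu i).
Proof.
have pair_sum (F : 'I_l -> int * int) (c : 'I_l -> nat) :
    \sum_i F i *+ c i = (\sum_i (F i).1 *+ c i, \sum_i (F i).2 *+ c i).
  by rewrite [LHS]surjective_pairing !raddf_sum; congr (_, _);
    apply: eq_bigr => i _; rewrite raddfMn.
rewrite /Lmap !pair_sum !big_split_ord /=.
by congr (_ + _, _ + _); apply: eq_bigr => j _;
  rewrite ?rev_lshift ?rev_rshift ?weight_lshift ?weight_rshift ?rev_ordK.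
Qed.

Lemma Lmap_bar nu : (Lmap p q (mnm_bar nu)).1 = (Lmap p q nu).2.
Proof.
rewrite !LmapE /= (reindex_inj rev_ord_inj) /=.
by apply: eq_bigr => i _; rewrite mnm_barE rev_ordK.
Qed.

Hypothesis p_geN1 : forall j, -1 <= p j.
Hypothesis pq_ge1 : forall j, 1 <= p j + (q j)%:Z.

Lemma sibirsky_monoidP nu :
  sibirsky_monoid p q nu <-> (Lmap p q nu).1 = (Lmap p q nu).2.
Proof.
split=> [[k -> //]|L12].
have L_ge0 : 0 <= (Lmap p q nu).1 + (Lmap p q nu).2.
  rewrite LmapE /= -big_split sumr_ge0 //= => i _; rewrite -mulrnDl mulrn_wge0 //.
  rewrite -(splitK i); case: (split i) => j /=;
    rewrite ?rev_lshift ?rev_rshift weight_lshift weight_rshift ?rev_ordK.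
    by have := pq_ge1 j; lia.
  by have := pq_ge1 (rev_ord j); lia.
exists `|(Lmap p q nu).1|%N; rewrite [LHS]surjective_pairing -L12.
by congr (_, _); lia.
Qed.

Lemma weight_geN1 i : -1 <= weight i.
Proof. by rewrite /weight; case: (split i) => j //; lia. Qed.

(** The exponent vector of [t ^ (weight i + 1) * y_i * y_(rev i)], with [t]
    as the variable 0 and the [y]'s after it. *)
Definition sibirsky_vector i : 'X_{1..(l + l).+1} :=
  [multinom oapp (fun j => (j == i) + (j == rev_ord i))%N `|(weight i + 1)%R|%N
            (unlift ord0 c) | c < (l + l).+1].

Local Notation texp := (toric_exp sibirsky_vector).

Lemma toric_exp_lift m i : texp m (lift ord0 i) = (m i + m (rev_ord i))%N.
Proof.
rewrite toric_expE.
under eq_bigr => j _ do rewrite mnmE liftK /= mulnDl.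
rewrite big_split /= (bigD1 i) //= eqxx mul1n big1 ?addn0 => [|j ne]; last first.
  by rewrite eq_sym (negPf ne).
congr (_ + _)%N; rewrite (bigD1 (rev_ord i)) //= rev_ordK eqxx mul1n.
rewrite big1 ?addn0 // => j ne; rewrite -(inj_eq rev_ord_inj) rev_ordK eq_sym.
by rewrite (negPf ne).
Qed.

Lemma toric_exp_ord0 m : (texp m ord0)%:Z = (Lmap p q m).1 + (mdeg m)%:Z.
Proof.
rewrite toric_expE LmapE mdegE /= !(natr_sum, PoszD, raddf_sum).
rewrite -big_split /=; apply: eq_bigr => i _.
rewrite mnmE unlift_none /= PoszM gez0_abs; last by have := weight_geN1 i; lia.
by rewrite mulrDl mul1r -mulr_natr natz.
Qed.

(** [nu] and its reversal have the same [y]-part and the same degree, so only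
    the first components of [L] can tell their images apart; reversal
    exchanges the components. *)
Lemma toric_exp_eq_bar nu :
  texp nu = texp (mnm_bar nu) <-> sibirsky_monoid p q nu.
Proof.
rewrite sibirsky_monoidP; split=> [e|L12].
  have := toric_exp_ord0 (mnm_bar nu).
  by rewrite -e toric_exp_ord0 mdeg_bar Lmap_bar; lia.
apply/mnmP => c; case: (unliftP ord0 c) => [j ->|->].
  by rewrite !toric_exp_lift !mnm_barE rev_ordK addnC.
have := toric_exp_ord0 (mnm_bar nu); have := toric_exp_ord0 nu.
by rewrite mdeg_bar Lmap_bar L12; lia.
Qed.

Lemma sibirsky_ideal_prime (R : realType) : prime_ideal (sibirsky_ideal p q R).
Proof.
apply: (toric_prime_ideal (v := sibirsky_vector)) => [_ [nu nuM <-]|m m' e].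
  by rewrite rmorphB /= !toric_mapX (toric_exp_eq_bar nu).2 // subrr.
have [i|g [nu [mE m'E]]] := @bar_decomposition _ m m' _.
  by rewrite -!toric_exp_lift e.
(* The exponents of the common factor cancel in e. *)
have nuM : sibirsky_monoid p q nu.
  apply/toric_exp_eq_bar/mnmP => c; move/mnmP/(_ c): e; rewrite mE m'E !toric_expE.
  under eq_bigr do rewrite mnmDE mulnDr.
  under [in RHS]eq_bigr do rewrite mnmDE mulnDr.
  by rewrite !big_split; apply: addnI.
rewrite mE m'E !mpolyXD -mulrBr; apply/ideal_genM/mem_ideal_gen.
by exists nu.
Qed.

End Sibirsky.

Theorem theorem2 (R : realType) (l : nat) (p : 'I_l -> int) (q : 'I_l -> nat)
    (l_ge1 : (1 <= l)%N)
    (p_geN1 : forall i : 'I_l, -1 <= p i)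
    (pq_inj : injective (fun i : 'I_l => (p i, q i)))
    (pq_ge1 : forall i : 'I_l, 1 <= p i + (q i)%:Z) :
  prime_ideal (sibirsky_ideal p q R).
Proof. exact: sibirsky_ideal_prime. Qed.
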